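(* Let $U\subseteq \mathbb Z$ and let $U=\bigcup_{\alpha} U_{\alpha}$ be a covering of $U$ by subsets $U_\alpha$ such that for every pair of indices $\alpha_1,\alpha_2$ (not necessarily distinct) and any distinct elements $a_1\in U_{\alpha_1}$, $a_2\in U_{\alpha_2}$, the intersection $U_{\alpha_1}\cap U_{\alpha_2}$ contains infinitely many terms of the arithmetic progression $a_1+(a_2-a_1)\mathbb Z$. Let $f\colon U\to\mathbb Z$. Then $f$ is LIP on $U$ if and only if for every $\alpha$ the restriction of $f$ to $U_\alpha$ is LIP on $U_\alpha$.
   Context: For a subset $S\subseteq\mathbb Z$, a function $g\colon S\to\mathbb Z$ is called LIP (locally integer polynomial) on $S$ if for every finite subset $X\subseteq S$ there is a polynomial $p\in\mathbb Z[x]$ with $p(x)=g(x)$ for all $x\in X$. *)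

(* Defs.v *)
From mathcomp Require Import all_boot all_order all_algebra.
From mathcomp Require Import boolp classical_sets functions cardinality.
Set Implicit Arguments.
Unset Strict Implicit.
Unset Printing Implicit Defensive.
Import GRing.Theory.
Local Open Scope classical_set_scope.
Local Open Scope ring_scope.

(* A function S -> Z is represented by a total function on int of which only
   the values on S matter; restricting it to a subset of S amounts to changing
   the set argument. *)
Definition LIP (S : set int) (g : int -> int) : Prop :=
  forall X : set int, finite_set X -> X `<=` S ->
    exists p : {poly int}, forall x : int, X x -> p.[x] = g x.

(* a + d Z, as the set of its terms. *)
Definition arith_prog (a d : int) : set int := [set a + d * k | k in setT].

(* Main.v *)
Require Import Defs.
From mathcomp Require Import all_boot all_order all_algebra.
From mathcomp Require Import boolp classical_sets functions cardinality.
From mathcomp Require Import ring.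
Import GRing.Theory.
Local Open Scope classical_set_scope.
Local Open Scope ring_scope.

(** Points of U are adjoined one at a time to all the members of the cover
    simultaneously. Suppose f is interpolated on every finite subset of
    V i `|` Y for every i, where Y is a finite subset of U, and let x be a new
    point, lying in V j. Given a finite set s in V i, choose for each a in s a
    new point b in V i `&` V j with a - x dividing b - x, and let B be the set of
    these b. Let p interpolate f on s, B and Y, and q on x, B and Y. Then p - q
    is a multiple of the product of the X - b for b in B and Y, so f x - p.[x] is
    a multiple of the product of the x - a for a in s and Y, and p can be
    corrected by a multiple of the product of the X - a. *)

Definition interpolable (f : int -> int) (s : seq int) : Prop :=
  exists p : {poly int}, {in s, forall x, p.[x] = f x}.

Lemma sub_interpolable (f : int -> int) (s t : seq int) :
  {subset s <= t} -> interpolable f t -> interpolable f s.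
Proof. by move=> st [p pf]; exists p => x /st; exact: pf. Qed.

Lemma LIP_interpolable (S : set int) (f : int -> int) :
  LIP S f <-> forall s : seq int, {in s, forall x, S x} -> interpolable f s.
Proof.
split=> [Sf s sS | Sf X /finite_seqP[s ->] sS].
  have [p pf] := Sf [set` s] (finite_seq s) sS.
  by exists p.
by have [p pf] := Sf s sS; exists p.
Qed.

(* [uniq_roots_prod_XsubC] asks for the differences of the roots to be units. *)
Lemma uniq_roots_idomain_dvd (R : idomainType) (p : {poly R}) (s : seq R) :
  uniq s -> all (root p) s -> exists q, p = q * \prod_(a <- s) ('X - a%:P).
Proof.
elim: s p => [|a s IHs] p /=; first by exists p; rewrite big_nil mulr1.
case/andP=> a_s uniq_s /andP[/factor_theorem[q ->] roots_s].
have [|r ->] := IHs q uniq_s; last by exists r; rewrite big_cons mulrA mulrAC.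
apply/allP => b b_s; move/allP: roots_s => /(_ b b_s).
rewrite rootM root_XsubC => /orP[//|/eqP b_a].
by rewrite -b_a b_s in a_s.
Qed.

Lemma infinite_set_notin (T : choiceType) (A : set T) (s : seq T) :
  infinite_set A -> exists2 x, A x & x \notin s.
Proof.
move=> A_inf; apply: contrapT => no_x; apply: A_inf.
apply: (sub_finite_set _ (finite_seq s)) => x Ax /=.
by apply/negP => xs; apply: no_x; exists x => //; apply/negP.
Qed.

(** Each [a] in [s] offers infinitely many [b] with [x - a] dividing [x - b], so [b] can avoid [t]
    and the earlier choices; distinctness is what the factor theorem needs later. *)
Lemma exists_dvd_prod (W : set int) (x : int) (s t : seq int) :
    uniq t -> {in s, forall a, infinite_set (W `&` arith_prog x (a - x))} ->
  exists B : seq int, [/\ uniq (B ++ t), {in B, forall b, W b} &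
    exists c, \prod_(b <- B) (x - b) = c * \prod_(a <- s) (x - a)].
Proof.
move=> uniq_t; elim: s => [|a s IHs] s_inf.
  by exists [::]; split=> //; exists 1; rewrite !big_nil mulr1.
have [b bs|B [uniq_B BW [c prodB]]] := IHs.
  by apply: s_inf; rewrite inE bs orbT.
have [b [Wb [k _ b_def]] b_B] := infinite_set_notin _ _ (B ++ t) (s_inf a (mem_head a s)).
exists (b :: B); split.
- by rewrite /= b_B.
- by move=> y; rewrite inE => /predU1P[->|/BW].
- by exists (k * c); rewrite !big_cons prodB -b_def; ring.
Qed.

(** Induction on [t], with [i] and [s] left general: the hypothesis is used both for [s ++ B] in
    [V i] and for [x :: B] in [V j]. *)
Lemma interpolable_cat (I : Type) (V : I -> set int) (f : int -> int)
    (V_inter : forall (i1 i2 : I) (a1 a2 : int),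
      V i1 a1 -> V i2 a2 -> a1 <> a2 ->
      infinite_set (V i1 `&` V i2 `&` arith_prog a1 (a2 - a1)))
    (V_f : forall i, LIP (V i) f) (t : seq int) :
    uniq t -> {in t, forall x, exists i, V i x} ->
  forall i (s : seq int), {in s, forall x, V i x} -> interpolable f (s ++ t).
Proof.
elim: t => [|x t IHt] /=.
  by move=> _ _ i s sV; rewrite cats0; move/LIP_interpolable: (V_f i); apply.
case/andP=> x_t uniq_t tV i s sV.
have {}IHt : forall i (s : seq int), {in s, forall x, V i x} ->
    interpolable f (s ++ t).
  by apply: IHt => // y yt; apply: tV; rewrite inE yt orbT.
have [x_s | x_s] := boolP (x \in s).
  apply: sub_interpolable (IHt i s sV) => y.
  by rewrite !mem_cat inE => /or3P[->|/eqP->|->]; rewrite ?x_s ?orbT.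
have [j Vjx] := tV x (mem_head x t).
have [a a_s|B [uniq_B BV [c prodB]]] :=
    exists_dvd_prod (V j `&` V i) x s t uniq_t.
  by apply: V_inter => //; [exact: sV | move=> xa; rewrite xa a_s in x_s].
have [y|p pf] := IHt i (s ++ B).
  by rewrite mem_cat => /orP[/sV|/BV[]].
have [y|q qf] := IHt j (x :: B).
  by rewrite inE => /predU1P[->|/BV[]].
have [|r pq] := uniq_roots_idomain_dvd _ (q - p) (B ++ t) uniq_B.
  apply/allP => y yBt; rewrite rootE hornerD hornerN subr_eq0 pf ?qf //.
    by rewrite /= inE yBt orbT.
  by rewrite -catA mem_cat yBt orbT.
pose P := \prod_(a <- s ++ t) ('X - a%:P) : {poly int}.
(* [P] vanishes on [s ++ t], so the values there are kept; at [x], [prodB] turns [q - p] into [r.[x]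
   * c * P.[x]]. *)
exists (p + (r.[x] * c) *: P) => y; rewrite hornerD hornerZ.
have [-> _|y_x] := eqVneq y x; last first.
  rewrite mem_cat inE (negPf y_x) /= -mem_cat => y_st.
  have /rootP-> : root P y by rewrite root_prod_XsubC.
  rewrite mulr0 addr0 pf // !mem_cat.
  by move: y_st; rewrite mem_cat => /orP[]->; rewrite ?orbT.
have prodE (u : seq int) :
    (\prod_(a <- u) ('X - a%:P)).[x] = \prod_(a <- u) (x - a).
  by rewrite horner_prod; apply: eq_bigr => a _; rewrite hornerXsubC.
rewrite -(qf x) ?mem_head // -[q](subrK p) pq hornerD hornerM !prodE.
by rewrite !big_cat /= prodB; ring.
Qed.

Theorem theorem9 (U : set int) (I : Type) (V : I -> set int)
  (U_cover : U = \bigcup_(i in setT) V i)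
  (V_inter : forall (i1 i2 : I) (a1 a2 : int),
      V i1 a1 -> V i2 a2 -> a1 <> a2 ->
      infinite_set (V i1 `&` V i2 `&` arith_prog a1 (a2 - a1)))
  (f : int -> int) :
  LIP U f <-> (forall i : I, LIP (V i) f).
Proof.
split=> [Uf i X X_fin XV | V_f].
  by apply: Uf X_fin _ => x /XV Vix; rewrite U_cover; exists i.
apply/LIP_interpolable => s sU.
have sV : {in undup s, forall x, exists i, V i x}.
  by move=> x; rewrite mem_undup => /sU; rewrite U_cover => -[i _ Vix]; exists i.
(* [I] may be empty, so the index at which to start from [[::]] comes from a point of [s]. *)
case: s => [|x s] in sU sV *; first by exists 0.
have [|i _] := sV x; first by rewrite mem_undup mem_head.
apply: sub_interpolable
  (interpolable_cat _ _ _ V_inter V_f _ (undup_uniq _) sV i [::] _) => // y.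
by rewrite mem_undup.
Qed.
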